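(* Let $\tau$ be an rp-tree with $n$ leaves. The cooperad structure map $g_\tau$ passes from $\Gamma_n$ and $o\Gamma_n$ to their quotients $\mathrm{Eil}(n)=\Gamma_n/I_n$ and $\mathrm{Eil}^o(n)=o\Gamma_n/oI_n$ respectively; that is, $g_\tau$ induces well-defined maps $\mathrm{Eil}(n)\to\bigotimes_{v_i}\mathrm{Eil}(|v_i|)$ and $\mathrm{Eil}^o(n)\to\bigotimes_{v_i}\mathrm{Eil}^o(|v_i|)$, where $v_i$ ranges over the internal vertices of $\tau$.
   Context: Fix a commutative ground ring $R$; write $\mathbf n=\{1,\dots,n\}$. Graphs. A Graph is a finite connected oriented graph, and an eoGraph is a finite connected (unoriented) graph with a total ordering of its edges, in both cases with vertices labeled bijectively by $\mathbf n$, each edge joining distinct vertices, multiple edges allowed. $\Gamma_n$ and $o\Gamma_n$ are the free $R$-modules on Graphs and eoGraphs labeled by $\mathbf n$; a disconnected graph is regarded as $0$ in these modules. Relations. $I_n\subset\Gamma_n$ is the submodule generated by: Arnold combinations (sums of three Graphs differing only in two edges among three distinct vertices $i,j,k$, these being respectively $\{i\to j,j\to k\}$, $\{j\to k,k\to i\}$, $\{k\to i,i\to j\}$); symmetry combinations (sums of two Graphs differing in the orientation of exactly one edge); and Graphs with two edges having the same pair of endpoints. $oI_n\subset o\Gamma_n$ is the submodule generated by: Arnold combinations of eoGraphs (sums of three eoGraphs differing only in two edges among three distinct vertices $i,j,k$, the two edges being ordered consecutively and in the same position in all three, first I then II, with (I,II) respectively $(ij,jk)$, $(jk,ki)$, $(ki,ij)$);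 symmetry combinations $G-\mathrm{sign}(\pi)G'$, where $G,G'$ differ only in the ordering of edges and $\pi$ is the permutation relating the orderings; and eoGraphs with two edges having the same pair of endpoints. rp-trees. An rp-tree is a rooted planar tree in the upper half-plane with a root edge, whose internal vertices may have any number of branches; for an internal vertex $v$, $|v|$ is its valence minus one, i.e. its number of branches. Label the leaves of $\tau$ by $1,\dots,n$ and the branches of each internal vertex $v$ by $1,\dots,|v|$, from left to right. Fix an ordering of the internal vertices of $\tau$, used in all tensor products $\bigotimes_{v_i}$. The map $g_\tau$. For distinct $j,k\in\mathbf n$ let $v$ be the nadir (vertex closest to the root) of the shortest path in $\tau$ between leaves $j$ and $k$, and let $J_v(j),J_v(k)$ be the labels of the branches of $v$ over which leaves $j$ and $k$ lie. For $G$ a Graph or eoGraph, $G_{v}$ is the graph on vertices $\{1,\dots,|v|\}$ having, for each edge of $G$ between $j$ and $k$ whose associated nadir is $v$, an edge between $J_v(j)$ and $J_v(k)$ (oriented from $J_v(j)$ to $J_v(k)$ if the edge is $j\to k$; respectively, with edges ordered as the edges of $G$ giving rise to them). On $\Gamma_n$, $g_\tau(G)=\bigotimes_{v_i}G_{v_i}\in\bigotimes_{v_i}\Gamma_{|v_i|}$; on $o\Gamma_n$, $g_\tau(G)=\mathrm{sign}(\pi)\bigotimes_{v_i}G_{v_i}\in\bigotimes_{v_i}o\Gamma_{|v_i|}$, where $\pi$ is the permutation relating the order of all edges in $\bigotimes_{v_i}G_{v_i}$ (concatenating factors) to their order within $G$. Extend linearly. *)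

(* Defs.v *)
From HB Require Import structures.
From mathcomp Require Import all_boot all_algebra.
From mathcomp Require Import perm finmap multiset boolp.
From mathcomp Require Import freeg.

Set Implicit Arguments.
Unset Strict Implicit.
Unset Printing Implicit Defensive.

Import GRing.Theory.

Local Open Scope ring_scope.
Local Open Scope quotient_scope.

Section QuotientModule.
Variables (R : pzRingType) (V : lmodType R) (S : V -> Prop).

Inductive span : V -> Prop :=
| span0 : span 0
| spanZD a s u : S s -> span u -> span (a *: s + u).

Lemma spanD x y : span x -> span y -> span (x + y).
Proof.
move=> sx sy; elim: sx => [|a s u Ss _ IH]; first by rewrite add0r.
by rewrite -addrA; apply: spanZD.
Qed.

Lemma spanZ a x : span x -> span (a *: x).
Proof.
elim=> [|b s u Ss _ IH]; first by rewrite scaler0; apply: span0.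
by rewrite scalerDr scalerA; apply: spanZD.
Qed.

Lemma spanN x : span x -> span (- x).
Proof. by rewrite -scaleN1r; apply: spanZ. Qed.

Lemma span_gen x : S x -> span x.
Proof.
by move=> Sx; rewrite -[x]addr0 -[x]scale1r; apply: spanZD; last exact: span0.
Qed.

Definition span_equiv (x y : V) : bool := `[< span (x - y) >].

Lemma span_equiv_is_equiv : equiv_class_of span_equiv.
Proof.
split=> [x|x y|y x z].
- by apply/asboolP; rewrite subrr; apply: span0.
- by apply/asboolP/asboolP => /spanN; rewrite opprB.
- move=> /asboolP xy /asboolP yz; apply/asboolP.
  by rewrite -[x](subrK y) -addrA; apply: spanD.
Qed.

Canonical span_equivRel := EquivRelPack span_equiv_is_equiv.

Definition quotmod : Type := {eq_quot span_equivRel}.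
HB.instance Definition _ := Choice.on quotmod.
HB.instance Definition _ := EqQuotient.on quotmod.

Definition qproj (x : V) : quotmod := \pi_quotmod x.

Lemma qproj_eq x y : qproj x = qproj y <-> span (x - y).
Proof.
split=> [/eqP|sxy]; first by rewrite eqmodE => /asboolP.
by apply/eqP; rewrite eqmodE; apply/asboolP.
Qed.

Lemma qproj_repr q : qproj (repr q) = q.
Proof. exact: reprK. Qed.

Lemma qproj_span x : span (repr (qproj x) - x).
Proof. by apply/qproj_eq; rewrite qproj_repr. Qed.

Definition quot_add (p q : quotmod) := qproj (repr p + repr q).
Definition quot_opp (p : quotmod) := qproj (- repr p).
Definition quot_scale a (p : quotmod) := qproj (a *: repr p).

Lemma quot_addE x y : quot_add (qproj x) (qproj y) = qproj (x + y).
Proof.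
by apply/qproj_eq; rewrite opprD addrACA; apply: spanD; apply: qproj_span.
Qed.

Lemma quot_oppE x : quot_opp (qproj x) = qproj (- x).
Proof. by apply/qproj_eq; rewrite -opprD; apply/spanN/qproj_span. Qed.

Lemma quot_scaleE a x : quot_scale a (qproj x) = qproj (a *: x).
Proof. by apply/qproj_eq; rewrite -scalerBr; apply/spanZ/qproj_span. Qed.

Lemma quot_addA : associative quot_add.
Proof.
move=> p q r; rewrite -(qproj_repr p) -(qproj_repr q) -(qproj_repr r).
by rewrite !quot_addE addrA.
Qed.

Lemma quot_addC : commutative quot_add.
Proof. by move=> p q; rewrite /quot_add addrC. Qed.

Lemma quot_add0 : left_id (qproj 0) quot_add.
Proof. by move=> p; rewrite -(qproj_repr p) quot_addE add0r. Qed.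

Lemma quot_addN : left_inverse (qproj 0) quot_opp quot_add.
Proof. by move=> p; rewrite -(qproj_repr p) quot_oppE quot_addE addNr. Qed.

HB.instance Definition _ :=
  GRing.isZmodule.Build quotmod quot_addA quot_addC quot_add0 quot_addN.

Lemma quot_scaleA a b p :
  quot_scale a (quot_scale b p) = quot_scale (a * b) p.
Proof. by rewrite -(qproj_repr p) !quot_scaleE scalerA. Qed.

Lemma quot_scale1 : left_id 1 quot_scale.
Proof. by move=> p; rewrite -(qproj_repr p) quot_scaleE scale1r. Qed.

Lemma quot_scaleDr : right_distributive quot_scale +%R.
Proof.
move=> a p q; rewrite -(qproj_repr p) -(qproj_repr q).
by rewrite [X in quot_scale _ X]quot_addE !quot_scaleE [RHS]quot_addE scalerDr.
Qed.

Lemma quot_scaleDl p : {morph quot_scale^~ p : a b / a + b}.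
Proof.
move=> a b; rewrite -(qproj_repr p) !quot_scaleE [RHS]quot_addE.
by rewrite scalerDl.
Qed.

HB.instance Definition _ :=
  GRing.Zmodule_isLmodule.Build R quotmod
    quot_scaleA quot_scale1 quot_scaleDr quot_scaleDl.

Lemma qproj_is_linear : linear qproj.
Proof.
move=> a x y.
by rewrite -[RHS]/(quot_add (quot_scale a _) _) quot_scaleE quot_addE.
Qed.

HB.instance Definition _ :=
  GRing.isLinear.Build R V quotmod *:%R qproj qproj_is_linear.

(* The map induced by f on the quotient; meaningful when f kills S. *)
Definition qlift (W : lmodType R) (f : V -> W) (q : quotmod) : W := f (repr q).

Lemma qliftE (W : lmodType R) (f : {linear V -> W}) :
  (forall s, S s -> f s = 0) -> forall x, qlift f (qproj x) = f x.
Proof.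
move=> fS x; apply/eqP; rewrite -subr_eq0 /qlift -linearB.
elim: (qproj_span x) => [|a s u Ss _ /eqP IH]; first by rewrite linear0.
by rewrite linearP IH fS // scaler0 addr0.
Qed.

Lemma qlift_is_linear (W : lmodType R) (f : {linear V -> W}) :
  (forall s, S s -> f s = 0) -> linear (qlift f).
Proof.
move=> fS a p q; rewrite -(qproj_repr p) -(qproj_repr q).
by rewrite -linearP !qliftE // linearP.
Qed.

End QuotientModule.

Section FreeModule.
Variables (R : nzRingType) (K : choiceType) (W : lmodType R) (f : K -> W).

HB.instance Definition _ :=
  GRing.isZmodMorphism.Build {freeg K / R} W (fglift f) (lift_is_additive f).

Lemma fglift_scale : scalable (fglift f : {freeg K / R} -> W).
Proof.
move=> a D.
have scU b k : a *: (<< b *g k >> : {freeg K / R}) = << a * b *g k >>.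
  by apply/eqP/freeg_eqP=> x; rewrite coeffZ !coeffU mulrA.
elim/freeg_ind_dom0: D => [|b k D _ _ IH]; first by rewrite !raddf0.
by rewrite !raddfD /= IH scU !liftU scalerA.
Qed.

HB.instance Definition _ :=
  GRing.isScalable.Build R {freeg K / R} W *:%R (fglift f) fglift_scale.

End FreeModule.

Section TensorProduct.
Variables (R : comNzRingType) (I : finType).
Implicit Types M N : I -> lmodType R.

(* The relations expressing that x |-> << x >> is linear in each coordinate. *)
Inductive multilinear M : {freeg (forall i, M i) / R} -> Prop :=
| MultilinearRel (x : forall i, M i) (i : I) (a : R) (u v : M i) :
    multilinear (<< dfwith x (a *: u + v) >>
                 - (a *: << dfwith x u >> + << dfwith x v >>)).

Definition tensor M : lmodType R := quotmod (@multilinear M).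

Definition tens M (x : forall i, M i) : tensor M :=
  qproj (@multilinear M) << x >>.

Definition tensor_map M N (f : forall i, {linear M i -> N i}) :
    tensor M -> tensor N :=
  qlift (fglift (fun x : forall i, M i => tens (fun i => f i (x i)))).

Lemma tens_linear M (x : forall i, M i) i a (u v : M i) :
  tens (dfwith x (a *: u + v)) = a *: tens (dfwith x u) + tens (dfwith x v).
Proof.
rewrite /tens -linearP; apply/qproj_eq/span_gen.
exact: MultilinearRel.
Qed.

Section Map.
Variables (M N : I -> lmodType R) (f : forall i, {linear M i -> N i}).

Let tmap0 : {linear {freeg (forall i, M i) / R} -> tensor N} :=
  fglift (fun x : forall i, M i => tens (fun i => f i (x i))).

Lemma tensor_map_kills s : multilinear s -> tmap0 s = 0.
Proof.
case=> x i a u v; rewrite linearB linearP /tmap0 /= !liftU !scale1r.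
have fdf w : (fun j => f j (dfwith x w j)) = dfwith (fun j => f j (x j)) (f i w).
  apply: functional_extensionality_dep => j.
  by case: dfwithP => [|k ik]; rewrite ?dfwith_in ?dfwith_out.
by rewrite !fdf linearP tens_linear subrr.
Qed.

Lemma tensor_map_is_linear : linear (tensor_map f).
Proof. exact: (qlift_is_linear tensor_map_kills). Qed.

Lemma tensor_mapE x : tensor_map f (tens x) = tens (fun i => f i (x i)).
Proof.
by rewrite /tensor_map (qliftE tensor_map_kills) /tmap0 /= liftU scale1r.
Qed.

HB.instance Definition _ :=
  GRing.isLinear.Build R (tensor M) (tensor N) *:%R (tensor_map f)
    tensor_map_is_linear.

End Map.
End TensorProduct.

(* Vertex labels are 0, ..., n - 1. The graph with no vertex counts as
   connected; it only occurs for trees having vertices without branches. *)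

(* Up to isomorphism fixing the labels, an oriented multigraph is the multiset
   of its edges i -> j, encoded as pairs (i, j). *)
Notation oedges n := {mset ('I_n * 'I_n)%type}%mset.

Definition oedges_adj n (E : oedges n) : rel 'I_n :=
  [rel i j | ((i, j) \in E) || ((j, i) \in E)].

Definition is_Graph n (E : oedges n) : bool :=
  all (fun e => e.1 != e.2) E
  && [forall i, forall j, connect (oedges_adj E) i j].

Record Graph n := MkGraph {
  edges : oedges n;
  edgesP : is_Graph edges
}.
HB.instance Definition _ n := [isSub for @edges n].
HB.instance Definition _ n := [Choice of Graph n by <:].

(* Up to isomorphism, a graph with totally ordered edges is the sequence of its
   edges, encoded as unordered pairs [set i; j]. *)
Definition eoedges n := seq {set 'I_n}.

Definition eoedges_adj n (s : eoedges n) : rel 'I_n :=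
  [rel i j | [set i; j] \in s].

Definition is_eoGraph n (s : eoedges n) : bool :=
  all (fun e : {set 'I_n} => #|e| == 2%N) s
  && [forall i, forall j, connect (eoedges_adj s) i j].

Record eoGraph n := MkEoGraph {
  ordered_edges : eoedges n;
  ordered_edgesP : is_eoGraph ordered_edges
}.
HB.instance Definition _ n := [isSub for @ordered_edges n].
HB.instance Definition _ n := [Choice of eoGraph n by <:].

Section Modules.
Variables (R : comNzRingType) (n : nat).

Definition Gamma : lmodType R := {freeg (Graph n) / R}.
Definition oGamma : lmodType R := {freeg (eoGraph n) / R}.

(* A disconnected graph is 0 in these modules. *)
Definition Gamma_of (E : oedges n) : Gamma :=
  if insub E is Some G then << G : Graph n >> else 0.
Definition oGamma_of (s : eoedges n) : oGamma :=
  if insub s is Some G then << G : eoGraph n >> else 0.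

Local Open Scope mset_scope.

Inductive I_gen : Gamma -> Prop :=
| I_arnold (E : oedges n) (i j k : 'I_n) (G1 G2 G3 : Graph n) of
    uniq [:: i; j; k]
    & edges G1 = E `+` [mset (i, j); (j, k)]
    & edges G2 = E `+` [mset (j, k); (k, i)]
    & edges G3 = E `+` [mset (k, i); (i, j)] :
    I_gen (<< G1 >> + << G2 >> + << G3 >>)
| I_symmetry (E : oedges n) (i j : 'I_n) (G1 G2 : Graph n) of
    edges G1 = E `+` [mset (i, j)]
    & edges G2 = E `+` [mset (j, i)] :
    I_gen (<< G1 >> + << G2 >>)
| I_multiple (E : oedges n) (e f : 'I_n * 'I_n) (G : Graph n) of
    edges G = E `+` [mset e; f]
    & [set e.1; e.2] = [set f.1; f.2] :
    I_gen << G >>.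

Inductive oI_gen : oGamma -> Prop :=
| oI_arnold (s1 s2 : eoedges n) (i j k : 'I_n) (G1 G2 G3 : eoGraph n) of
    uniq [:: i; j; k]
    & ordered_edges G1 = s1 ++ [:: [set i; j]; [set j; k]] ++ s2
    & ordered_edges G2 = s1 ++ [:: [set j; k]; [set k; i]] ++ s2
    & ordered_edges G3 = s1 ++ [:: [set k; i]; [set i; j]] ++ s2 :
    oI_gen (<< G1 >> + << G2 >> + << G3 >>)
| oI_symmetry (G1 G2 : eoGraph n) (p : 'S_(size (ordered_edges G1))) of
    ordered_edges G2 = [seq nth set0 (ordered_edges G1) (p l)
                       | l <- enum 'I_(size (ordered_edges G1))] :
    oI_gen (<< G1 >> - (-1) ^+ p *: << G2 >>)
| oI_multiple (G : eoGraph n) of ~~ uniq (ordered_edges G) :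
    oI_gen << G >>.

Definition Eil : lmodType R := quotmod I_gen.
Definition oEil : lmodType R := quotmod oI_gen.

Definition Eil_proj : {linear Gamma -> Eil} := qproj I_gen.
Definition oEil_proj : {linear oGamma -> oEil} := qproj oI_gen.

End Modules.

(* The root edge is implicit: it ends at the leaf or internal vertex that is
   the head constructor. *)
Inductive rptree := Leaf | Node of seq rptree.

(* A leaf or internal vertex is addressed by the branches (numbered from 0,
   left to right) taken on the way up from the lowest vertex. *)
Definition address := seq nat.

Definition graft (ls : seq (seq address)) : seq address :=
  [seq i :: a | i <- iota 0 (size ls), a <- nth [::] ls i].

Fixpoint leaves (t : rptree) : seq address :=
  if t is Node ts then graft (map leaves ts) else [:: [::]].

Fixpoint internal_vertices (t : rptree) : seq address :=
  if t is Node ts then [::] :: graft (map internal_vertices ts) else [::].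

(* The number |v| of branches of the internal vertex v. *)
Fixpoint arity (t : rptree) (v : address) : nat :=
  match t, v with
  | Node ts, [::] => size ts
  | Node ts, i :: v' => arity (nth Leaf ts i) v'
  | Leaf, _ => 0
  end.

Fixpoint lcp (a b : address) : address :=
  match a, b with
  | x :: a', y :: b' => if x == y then x :: lcp a' b' else [::]
  | _, _ => [::]
  end.

Lemma lcp_prefixl a b : prefix (lcp a b) a.
Proof.
elim: a b => [|x a IH] [|y b] //=.
by case: eqP => //= _; rewrite eqxx IH.
Qed.

Lemma lcpC a b : lcp a b = lcp b a.
Proof.
elim: a b => [|x a IH] [|y b] //=.
by rewrite eq_sym; case: eqP => // ->; rewrite IH.
Qed.

Lemma lcp_prefixr a b : prefix (lcp a b) b.
Proof. by rewrite lcpC lcp_prefixl. Qed.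

Lemma prefix_lcp c a b : prefix c a -> prefix c b -> prefix c (lcp a b).
Proof.
elim: c a b => [|z c IH] [|x a] [|y b] //=; first by rewrite prefix0s.
by case/andP=> /eqP<- ca /andP[/eqP<- cb]; rewrite eqxx /= eqxx IH.
Qed.

(* Two vertices are adjacent when one is reached from the other by going up
   along one branch. *)
Definition adjacent (a b : address) : bool :=
  prefix a b && (size b == (size a).+1) || prefix b a && (size a == (size b).+1).

Lemma prefix_adjacent d a b : adjacent a b -> prefix d a -> ~~ prefix d b ->
  d = a /\ b = take (size d).-1 d.
Proof.
case/orP=> /andP[pab /eqP sz] pda; first by rewrite (prefix_trans pda pab).
move: pab sz pda; rewrite !prefixE => /eqP Eb sz /eqP Ed ndb.
have ldb : (size b < size d)%N.
  rewrite ltnNge; apply: contra ndb => ldb.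
  by rewrite -[X in take _ X]Eb take_takel // Ed.
have lda : (size d <= size a)%N by rewrite -Ed size_take_min geq_minr.
have Eda : size d = size a by apply/eqP; rewrite eqn_leq lda sz.
have da : d = a by rewrite -Ed Eda take_size.
by rewrite da sz Eb.
Qed.

Lemma adjacentC a b : adjacent a b = adjacent b a.
Proof. by rewrite /adjacent orbC. Qed.

Lemma path_exit d a p : path adjacent a p -> prefix d a ->
  ~~ prefix d (last a p) -> d \in a :: p /\ take (size d).-1 d \in p.
Proof.
elim: p a => [|b p IH] a /= ; first by move=> _ ->.
case/andP=> ab bp da nd; have [db|ndb] := boolP (prefix d b).
  by have [dp tp] := IH b bp db nd; rewrite inE dp inE tp !orbT.
have [eda <-] := prefix_adjacent ab da ndb.
by rewrite eda !mem_head.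
Qed.

Lemma path_enter d a p : path adjacent a p -> ~~ prefix d a ->
  prefix d (last a p) -> d \in p.
Proof.
elim: p a => [|b p IH] a /=; first by move=> _ /negbTE->.
case/andP=> ab bp nda dl; have [db|ndb] := boolP (prefix d b).
  by rewrite adjacentC in ab; have [-> _] := prefix_adjacent ab db nda; rewrite mem_head.
by rewrite inE (IH b) ?orbT.
Qed.

(* On the path between two vertices, their longest common prefix is the vertex
   closest to the root. *)
Lemma lcp_nadir a p (c := lcp a (last a p)) :
  path adjacent a p -> uniq (a :: p) ->
  c \in a :: p /\ forall v, v \in a :: p -> prefix c v.
Proof.
move=> ap; have ca : prefix c a := lcp_prefixl _ _.
have cb : prefix c (last a p) := lcp_prefixr _ _.
move=> up; split.
  have Ec : take (size c) a = c by apply/eqP; rewrite -prefixE.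
  have [sca|nca] := eqVneq (size c) (size a).
    by rewrite -Ec sca take_size mem_head.
  have sd : size (take (size c).+1 a) = (size c).+1.
    by rewrite size_takel // ltn_neqAle nca size_prefix.
  rewrite inE; apply/orP; right.
  have -> : c = take (size (take (size c).+1 a)).-1 (take (size c).+1 a).
    by rewrite sd /= take_takel ?Ec.
  have pd : prefix (take (size c).+1 a) a by apply: prefix_take.
  apply: (proj2 (path_exit ap pd _)); apply/negP => /(prefix_lcp pd).
  by move/size_prefix; rewrite sd ltnn.
move=> v /splitPl; case Ep: _ / => [p1 p2 lv].
apply: contraT => ncv; move: ap up; rewrite Ep cat_path -cat_cons cat_uniq lv.
case/andP=> ap1 vp2 /and3P[_ /hasPn dis _].
have [cp1 _] : c \in a :: p1 /\ take (size c).-1 c \in p1.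
  by apply: path_exit; rewrite ?lv.
have /dis : c \in p2.
  by apply: (path_enter vp2 ncv); rewrite -lv -last_cat -Ep.
by rewrite /= cp1.
Qed.

Lemma mem_graft ls a :
  reflect (exists i b, [/\ (i < size ls)%N, b \in nth [::] ls i & a = i :: b])
          (a \in graft ls).
Proof.
apply: (iffP allpairsPdep) => [[i [b [+ bi ->]]]|[i [b [li bi ->]]]].
  by rewrite mem_iota => li; exists i, b.
by exists i, b; rewrite mem_iota.
Qed.

Lemma rptree_nested_ind (P : rptree -> Prop) :
  P Leaf ->
  (forall ts, (forall i, (i < size ts)%N -> P (nth Leaf ts i)) -> P (Node ts)) ->
  forall t, P t.
Proof.
move=> PL PN; fix IH 1 => -[|ts]; first exact: PL.
apply: PN; elim: ts => [|t ts IHts] [|i] lti; last exact: IHts.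
- by [].
- by [].
- exact: IH.
Qed.

(* Two distinct leaves lie over distinct branches of an internal vertex, which
   is the longest common prefix of their addresses. *)
Lemma lcp_leaves t a b : a \in leaves t -> b \in leaves t -> a != b ->
  let v := lcp a b in
  [/\ v \in internal_vertices t,
      (nth 0 a (size v) < arity t v)%N,
      (nth 0 b (size v) < arity t v)%N
    & nth 0%N a (size v) != nth 0%N b (size v)].
Proof.
elim/rptree_nested_ind: t a b => [|ts IH] a b /=.
  by rewrite !inE => /eqP-> /eqP->; rewrite eqxx.
case/mem_graft=> i [a' [+ + ->]] /mem_graft[j [b' [+ + ->]]].
rewrite !size_map => li a'i lj b'j.
rewrite (nth_map Leaf) // in a'i; rewrite (nth_map Leaf) // in b'j.
have [eij|nij _] := boolP (i == j); last by rewrite /= (negbTE nij).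
move/eqP: eij b'j lj => <- b'j _; rewrite eqseq_cons eqxx /= => nab.
have [vi la lb d] := IH i li a' b' a'i b'j nab; rewrite /= eqxx.
split=> //; apply/orP; right; apply/mem_graft.
by exists i, (lcp a' b'); rewrite size_map (nth_map Leaf).
Qed.

Section StructureMap.
Variables (R : comNzRingType) (n : nat) (t : rptree).

Definition leaf (j : 'I_n) : address := nth [::] (leaves t) j.

(* The vertex closest to the root on the path between leaves j and k: see
   lcp_nadir, and lcp_leaves for j != k. *)
Definition nadir (j k : 'I_n) : address := lcp (leaf j) (leaf k).

(* J_v(j), with branches numbered from 0; meaningful when leaf j lies over v. *)
Definition branch (v : address) (j : 'I_n) : nat := nth 0%N (leaf j) (size v).

(* The edge of G_v coming from the edge e of G. The insertions into 'I_|v| are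
   defined whenever v is the nadir of e, see lcp_leaves. *)
Definition edge_at (v : address) (e : 'I_n * 'I_n) :
    option ('I_(arity t v) * 'I_(arity t v)) :=
  if insub (branch v e.1) is Some a then
    if insub (branch v e.2) is Some b then Some (a, b) else None
  else None.

Definition graph_at (v : address) (E : oedges n) : oedges (arity t v) :=
  seq_mset (pmap (edge_at v) [seq e <- (E : seq _) | nadir e.1 e.2 == v]).

(* v is the nadir associated with the unordered edge e. *)
Definition has_nadir (e : {set 'I_n}) (v : address) : bool :=
  [forall j in e, forall k in e, (j != k) ==> (nadir j k == v)].

Definition oedge_at (v : address) (e : {set 'I_n}) : {set 'I_(arity t v)} :=
  [set a : 'I_(arity t v) | [exists j in e, branch v j == a]].

Definition eograph_at (v : address) (s : eoedges n) : eoedges (arity t v) :=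
  [seq oedge_at v e | e <- s & has_nadir e v].

Variable vs : seq address.

Definition vertex (i : 'I_(size vs)) : address := nth [::] vs i.

(* The positions in s of the edges of the factors G_v, v in vs, the factors
   being concatenated. *)
Definition concat_order (s : eoedges n) : seq 'I_(size s) :=
  [seq l | v <- vs, l <- [seq l : 'I_(size s) <- enum 'I_(size s) |
                             has_nadir (nth set0 s l) v]].

(* The permutation relating the two orders (the default value is irrelevant,
   see edge_permP): the l-th edge of the concatenation is the (p l)-th of s. *)
Definition edge_perm (s : eoedges n) : 'S_(size s) :=
  odflt 1%g [pick p : 'S_(size s) |
    concat_order s == [seq p l | l <- enum 'I_(size s)]].

Definition g : {linear Gamma R n ->
    tensor (fun i : 'I_(size vs) => Gamma R (arity t (vertex i)))} :=
  fglift (fun G : Graph n =>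
    tens (fun i => Gamma_of R (graph_at (vertex i) (edges G)))).

Definition og : {linear oGamma R n ->
    tensor (fun i : 'I_(size vs) => oGamma R (arity t (vertex i)))} :=
  fglift (fun G : eoGraph n =>
    (-1) ^+ edge_perm (ordered_edges G) *:
    tens (fun i => oGamma_of R (eograph_at (vertex i) (ordered_edges G)))).


End StructureMap.

Lemma graft_uniq ls :
  (forall i, (i < size ls)%N -> uniq (nth [::] ls i)) -> uniq (graft ls).
Proof.
move=> uls; apply: allpairs_uniq_dep; last by move=> [i a] [j b] _ _ /= [-> ->].
  exact: iota_uniq.
by move=> i; rewrite mem_iota; apply: uls.
Qed.

Lemma internal_vertices_uniq t : uniq (internal_vertices t).
Proof.
elim/rptree_nested_ind: t => [|ts IH] //=; apply/andP; split.
  by apply/mem_graft => -[i [b []]].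
apply: graft_uniq => i; rewrite size_map => li.
by rewrite (nth_map Leaf) // IH.
Qed.

Lemma leaves_uniq t : uniq (leaves t).
Proof.
elim/rptree_nested_ind: t => [|ts IH] //=.
apply: graft_uniq => i; rewrite size_map => li.
by rewrite (nth_map Leaf) // IH.
Qed.

Lemma has_nadir2 n t (j k : 'I_n) v : j != k ->
  has_nadir t [set j; k] v = (nadir t j k == v).
Proof.
move=> njk; apply/forall_inP/eqP => [H|<- x].
  have /forall_inP/(_ k) := H j (set21 j k).
  by rewrite set22 njk => /(_ isT)/eqP.
case/set2P=> ->; apply/forall_inP => y /set2P[] ->; rewrite ?eqxx //.
- exact/implyP.
- by apply/implyP => _; rewrite /nadir lcpC.
Qed.

Lemma edge_permP n t vs (G : eoGraph n) :
  size (leaves t) = n -> perm_eq vs (internal_vertices t) ->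
  concat_order t vs (ordered_edges G)
  = [seq edge_perm t vs (ordered_edges G) l
    | l <- enum 'I_(size (ordered_edges G))].
Proof.
move=> tn vsP; set s := ordered_edges G; set cs := concat_order t vs s.
have sP (l : 'I_(size s)) : exists2 v, v \in vs &
    forall w, has_nadir t (nth set0 s l) w = (v == w).
  have /cards2P[j [k [njk ->]]] : #|nth set0 s l| == 2%N.
    by have /andP[/allP s2 _] := ordered_edgesP G; apply/s2/mem_nth.
  exists (nadir t j k); last by move=> w; rewrite has_nadir2.
  have lf (i : 'I_n) : leaf t i \in leaves t by rewrite mem_nth // tn.
  have [] // := @lcp_leaves t (leaf t j) (leaf t k).
    by rewrite nth_uniq ?tn ?leaves_uniq.
  by rewrite (perm_mem vsP).
have ucs : uniq cs.
  apply: allpairs_uniq_dep.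
  - by rewrite (perm_uniq vsP) internal_vertices_uniq.
  - by move=> v _; rewrite filter_uniq ?enum_uniq.
  move=> _ _ /allpairsPdep[v [l [_ + ->]]] /allpairsPdep[w [m [_ + ->]]] /=.
  rewrite !mem_filter => /andP[lv _] /andP[mw _] elm; move: lv mw; rewrite elm.
  by have [u _ uP] := sP m; rewrite !uP => /eqP<- /eqP<-.
have csT l : l \in cs.
  have [v vvs vP] := sP l; apply/allpairsPdep; exists v, l.
  by rewrite mem_filter vP eqxx mem_enum.
have szcs : size cs = size s.
  rewrite -[RHS]card_ord cardE; apply/perm_size/uniq_perm; rewrite ?enum_uniq //.
  by move=> l; rewrite csT mem_enum.
have inj : injective (fun l : 'I_(size s) => nth l cs l).
  move=> l m /eqP; rewrite (set_nth_default m) ?szcs //.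
  by rewrite nth_uniq ?szcs // => /eqP/val_inj.
rewrite /edge_perm; case: pickP => [p /eqP //|/(_ (perm inj))/eqP[]].
rewrite -/cs; have [s0|s_gt0] := posnP (size s).
  apply: (etrans (size0nil _)); rewrite ?szcs //; apply/esym/size0nil.
  by rewrite size_map -cardE card_ord.
pose l0 := Ordinal s_gt0; apply: (@eq_from_nth _ l0).
  by rewrite size_map -cardE card_ord.
move=> i; rewrite szcs => li; rewrite (nth_map l0) -?cardE ?card_ord // permE.
by rewrite (nth_enum_ord l0 li) (set_nth_default l0) ?szcs // (nth_enum_ord l0 li).
Qed.

(* Main.v *)
(* It suffices that g_tau, followed by the projections onto the Eil(|v_i|),
   kills every generator. In each case only one tensor factor matters. For an
   Arnold combination on i, j, k, either the three nadirs agree and J_v(i),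
   J_v(j), J_v(k) are distinct, giving an Arnold combination at v; or, up to
   rotation, nadir(j,k) = nadir(k,i) = v lies strictly below nadir(i,j), and
   J_v(i) = J_v(j). Then the second graph acquires a double edge at v, and the
   other two differ at v by reversing an edge (in the ordered setting, by
   exchanging two consecutive edges with different nadirs). For ordered edges,
   exchanging two consecutive edges changes either the sign of the permutation
   pi or the order of the edges of a single factor, but never both; general
   permutations follow since such exchanges generate the symmetric group. *)

Require Import Defs.
From mathcomp Require Import all_boot all_algebra.
From mathcomp Require Import perm finmap multiset boolp.
From mathcomp Require Import freeg.

Set Implicit Arguments.
Unset Strict Implicit.
Unset Printing Implicit Defensive.

Import GRing.Theory.

Local Open Scope ring_scope.

(** * Linear maps out of quotients, and pure tensors differing in one factor *)

Lemma linearD3 (R : pzRingType) (U V : lmodType R) (f : {linear U -> V}) x y z :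
  f (x + y + z) = f x + f y + f z.
Proof. by rewrite !linearD. Qed.

(** Reduces the theorem to checking that generators are killed. Uniqueness holds because every class
    is the image of its representative [repr]. *)
Lemma qlift_unique (R : pzRingType) (V W : lmodType R) (S : V -> Prop)
    (f : {linear V -> W}) :
    (forall s, S s -> f s = 0) ->
  exists! h : quotmod S -> W, linear h /\ forall x, h (qproj S x) = f x.
Proof.
move=> fS; exists (qlift f); split.
  by split; [apply: qlift_is_linear | apply: qliftE].
move=> h [_ hE]; apply: functional_extensionality_dep => q.
by rewrite -(qproj_repr q) hE qliftE.
Qed.

(** Brings a family that differs from x only at i into the shape on which [tens_linear] acts. *)
Lemma dfwith_agree (I : eqType) (T : I -> Type) (x y : forall i, T i) (i : I) :
  (forall j, i != j -> y j = x j) -> y = eqtype.dfwith x (y i).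
Proof.
move=> xy; apply: functional_extensionality_dep => j.
by case: eqtype.dfwithP => // k /xy.
Qed.

Section Tensors.
Variables (R : comNzRingType) (I : finType) (M : I -> lmodType R).
Implicit Types x y z : forall i, M i.

Lemma tens_eq0 x i : x i = 0 -> tens x = 0.
Proof.
move=> x0; rewrite (@dfwith_agree _ _ x x i) // x0.
(* With coefficient -1 and both vectors 0, linearity reads T = - T + T for the tensor T in
   question. *)
have := tens_linear x (-1) (0 : M i) 0.
by rewrite scaler0 addr0 scaleN1r addNr.
Qed.

Lemma tens_opp x y i :
  (forall j, i != j -> x j = y j) -> x i = - y i -> tens x = - tens y.
Proof.
move=> xy xyi; rewrite (dfwith_agree xy) xyi -scaleN1r -[_ *: _]addr0.
(* Linearity is available in the form a u + v; here v = 0 contributes a tensor that vanishes. *)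
rewrite tens_linear scaleN1r [X in _ + X](@tens_eq0 _ i) ?eqtype.dfwith_in //.
by rewrite addr0 -(@dfwith_agree _ _ y y).
Qed.

(** Linearity in coordinate i merges the three tensors into one whose entry there is 0. *)
Lemma tens_add3 x y z i :
    (forall j, i != j -> y j = x j) -> (forall j, i != j -> z j = x j) ->
  x i + y i + z i = 0 -> tens x + tens y + tens z = 0.
Proof.
move=> yx zx sum0; rewrite (dfwith_agree yx) (dfwith_agree zx).
rewrite [in tens x](@dfwith_agree _ _ x x i) // -[tens _ + tens _]addrC.
rewrite -[X in X + _ + _]scale1r -tens_linear -[X in X + _]scale1r -tens_linear.
apply: (@tens_eq0 _ i).
by rewrite eqtype.dfwith_in !scale1r [X in X + _]addrC.
Qed.

End Tensors.

(** * Nadirs *)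

(** At the lowest vertex where the three paths from the root no longer all continue together, at
    least two of the three pairs separate, and these have that vertex as common nadir. *)
Lemma lcp_ultrametric a b c :
  [\/ lcp b c = lcp c a, lcp c a = lcp a b | lcp a b = lcp b c].
Proof.
elim: a b c => [|x a IH] [|y b] [|z c] /=;
  try by [constructor 1 | constructor 2 | constructor 3].
case: (eqVneq x y) => [exy|xy]; case: (eqVneq z x) => [ezx|zx]; try subst y; try subst z.
- by rewrite eqxx; have [->|->|->] := IH b c; [constructor 1|constructor 2|constructor 3].
- by rewrite eq_sym (negbTE zx); constructor 1.
- by rewrite eq_sym (negbTE xy); constructor 3.
- by constructor 2.
Qed.

(** The common value is a prefix of both a and b. If [lcp a b] differs from it, it is strictly
    longer, so a and b leave that vertex along the same branch. This is what makes J_v(i) = J_v(j)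
    in the unequal case. *)
Lemma lcp_isosceles a b c : lcp b c = lcp c a -> lcp a b != lcp c a ->
  nth 0%N a (size (lcp c a)) = nth 0%N b (size (lcp c a)).
Proof.
elim: a b c => [|x a IH] [|y b] [|z c] //=.
- by move=> <-.
- by case: (eqVneq x y) => [->|].
case: (eqVneq z x) => [->|zx] /=; last by case: (eqVneq x y) => [->|].
case: (eqVneq x y) => [<-|_] /=; last by [].
by case=> [/IH H]; rewrite eqseq_cons eqxx.
Qed.

Section Nadirs.
Variables (n : nat) (t : rptree).
Hypothesis t_leaves : size (leaves t) = n.
Implicit Types i j k : 'I_n.

Lemma nadirC j k : nadir t j k = nadir t k j.
Proof. exact: lcpC. Qed.

(** Supplies J_v(j) and J_v(k) as vertices of the factor at v. *)
Lemma nadir_branches v j k : j != k -> nadir t j k = v ->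
  v \in internal_vertices t /\ exists a b : 'I_(arity t v),
    [/\ a != b, a = branch t v j :> nat & b = branch t v k :> nat].
Proof.
move=> jk <-; have lf (i : 'I_n) : leaf t i \in leaves t by rewrite mem_nth // t_leaves.
have [|vt lj lk d] := lcp_leaves (lf j) (lf k).
  by rewrite nth_uniq ?t_leaves ?leaves_uniq.
by split=> //; exists (Ordinal lj), (Ordinal lk).
Qed.

(** The case split shared by both Arnold arguments. Two of the three nadirs always coincide, and as
    P is invariant under rotation these may be taken to be the nadirs of j, k and of k, i. *)
Lemma nadir_triple (P : 'I_n -> 'I_n -> 'I_n -> Prop) :
    (forall i j k, P i j k -> P j k i) ->
    (forall i j k v (a b c : 'I_(arity t v)), uniq [:: i; j; k] -> uniq [:: a; b; c] ->
      nadir t i j = v -> nadir t j k = v -> nadir t k i = v ->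
      a = branch t v i :> nat -> b = branch t v j :> nat -> c = branch t v k :> nat ->
      P i j k) ->
    (forall i j k v (a b : 'I_(arity t v)), uniq [:: i; j; k] -> a != b ->
      nadir t i j != v -> nadir t j k = v -> nadir t k i = v ->
      a = branch t v i :> nat -> a = branch t v j :> nat -> b = branch t v k :> nat ->
      P i j k) ->
  forall i j k, uniq [:: i; j; k] -> P i j k.
Proof.
move=> Prot Peq Pne.
have main i j k v : uniq [:: i; j; k] -> nadir t k i = v -> nadir t j k = v -> P i j k.
  move=> u kiv jkv; move: (u).
  rewrite /= !inE negb_or andbT [i == k]eq_sym => /andP[/andP[ij ki] jk].
  have [_ [c [a [ca ck ai]]]] := nadir_branches ki kiv.
  have [_ [b [c' [bc bj ck']]]] := nadir_branches jk jkv.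
  (* Both are J_v(k), obtained once from the pair k, i and once from j, k. *)
  have ec : c' = c by apply: val_inj; rewrite /= ck ck'.
  move: bc; rewrite {}ec {c' ck'} => bc.
  rewrite eq_sym in ca; have [ijv|ijv] := eqVneq (nadir t i j) v.
    have [_ [a' [b' [ab ai' bj']]]] := nadir_branches ij ijv.
    apply: (Peq i j k v a b c) => //.
    rewrite /= !inE negb_or ca bc !andbT.
    (* If a = b, then i and j would lie over the same branch of v, which is their nadir. *)
    by apply: contra ab => /eqP ab; rewrite -val_eqE /= ai' bj' -ai -bj ab.
  apply: (Pne i j k v a c) => //; rewrite ai /branch -kiv.
  by apply: lcp_isosceles; rewrite -!/(nadir _ _ _) ?jkv kiv.
move=> i j k u; have u' : uniq [:: j; k; i] by rewrite -(rot_uniq 2).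
have u'' : uniq [:: k; i; j] by rewrite -(rot_uniq 1).
have [jk|ki|ij] := lcp_ultrametric (leaf t i) (leaf t j) (leaf t k).
- exact: main jk.
- by apply/(Prot k i j)/(Prot j k i)/(main _ _ _ _ _ _ ki).
- by apply/(Prot k i j)/(main _ _ _ _ _ _ ij).
Qed.

End Nadirs.

(** * Oriented graphs *)

Section OrientedRelations.
Variables (R : comNzRingType) (n : nat).
Implicit Types (E : oedges n) (i j k : 'I_n) (e f : 'I_n * 'I_n).

Lemma Gamma_ofT E (GE : is_Graph E) : Gamma_of R E = << MkGraph GE >>.
Proof. by rewrite /Gamma_of insubT. Qed.

Lemma Gamma_ofF E : ~~ is_Graph E -> Gamma_of R E = 0.
Proof. by move=> GE; rewrite /Gamma_of insubF //; apply/negbTE. Qed.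

(** Defined on arbitrary edge multisets, with value 0 on those that are not Graphs, so that the
    relations below apply to every factor G_v, connected or not. *)
Definition Eil_class E : Eil R n := Eil_proj R n (Gamma_of R E).

Lemma Eil_proj0 x : I_gen x -> Eil_proj R n x = 0.
Proof.
move=> xI; rewrite -(linear0 (Eil_proj R n)); apply/qproj_eq.
by rewrite subr0; apply: span_gen.
Qed.

Local Open Scope mset_scope.

Lemma oedges_adjE E i j : oedges_adj E i j = ((i, j) \in E) || ((j, i) \in E).
Proof. by []. Qed.

(** Connectedness survives when each edge is replaced by a path. It serves to show that the terms of
    a relation are either all Graphs or all 0. *)
Lemma is_Graph_sub E E' :
    {in E, forall e, connect (oedges_adj E') e.1 e.2} ->
    {in E', forall e, e.1 != e.2} -> is_Graph E -> is_Graph E'.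
Proof.
move=> EE' /allP lE' /andP[_ /forallP cE]; rewrite /is_Graph lE'.
have symE' : connect_sym (oedges_adj E').
  by apply: sym_connect_sym => i j; apply: orbC.
apply/forallP => i; apply/forallP => j; have /forallP/(_ j) := cE i.
by apply: connect_sub => {}i {}j /orP[/EE' //|/EE']; rewrite symE'.
Qed.

Lemma Eil_symmetry E i j :
  Eil_class (E `+` [mset (i, j)]) = - Eil_class (E `+` [mset (j, i)]).
Proof.
have flip k l : is_Graph (E `+` [mset (k, l)]) -> is_Graph (E `+` [mset (l, k)]).
  move=> GE; have /andP[/allP lE _] := GE; apply: is_Graph_sub GE => e.
    rewrite in_msetD in_mset1 => /orP[eE|/eqP->] /=; apply: connect1; rewrite oedges_adjE.
      by rewrite in_msetD -surjective_pairing eE.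
    by rewrite !in_msetD !in_mset1 eqxx !orbT.
  rewrite in_msetD in_mset1 => /orP[eE|/eqP->] /=; first by rewrite lE ?in_msetD ?eE.
  by rewrite eq_sym (lE (k, l)) // in_msetD in_mset1 eqxx orbT.
apply/eqP; rewrite -addr_eq0 -(linearD (Eil_proj R n)); apply/eqP.
have [GE|GE] := boolP (is_Graph (E `+` [mset (i, j)])); last first.
  by rewrite (Gamma_ofF GE) (Gamma_ofF (contra (@flip j i) GE)) addr0 linear0.
rewrite (Gamma_ofT GE) (Gamma_ofT (flip _ _ GE)); apply: Eil_proj0.
exact: (@I_symmetry _ _ E i j).
Qed.

Lemma Eil_arnold E i j k : uniq [:: i; j; k] ->
  Eil_class (E `+` [mset (i, j); (j, k)]) + Eil_class (E `+` [mset (j, k); (k, i)])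
    + Eil_class (E `+` [mset (k, i); (i, j)]) = 0.
Proof.
(* The edge from a to b is lost, but the path through c replaces it. Rotating three times closes the
   cycle, so the three terms are Graphs simultaneously. *)
have rot a b c : uniq [:: a; b; c] ->
    is_Graph (E `+` [mset (a, b); (b, c)]) -> is_Graph (E `+` [mset (b, c); (c, a)]).
  rewrite /= !inE negb_or !andbT => /andP[/andP[ab ac] bc] GE.
  have /andP[/allP lE _] := GE; apply: is_Graph_sub GE => e.
    rewrite !in_msetD !in_mset1 => /or3P[eE|/eqP->|/eqP->] /=.
    - by apply: connect1; rewrite oedges_adjE in_msetD -surjective_pairing eE.
    - by apply: (@connect_trans _ _ c); apply: connect1;
        rewrite oedges_adjE !in_msetD !in_mset1 ?eqxx ?orbT.
    - by apply: connect1; rewrite oedges_adjE !in_msetD !in_mset1 ?eqxx ?orbT.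
  rewrite !in_msetD !in_mset1 => /or3P[eE|/eqP->|/eqP->] //=; last by rewrite eq_sym.
  by rewrite lE ?in_msetD ?eE.
move=> u; have u' : uniq [:: j; k; i] by rewrite -(rot_uniq 2).
have u'' : uniq [:: k; i; j] by rewrite -(rot_uniq 1).
rewrite /Eil_class -linearD3.
have [GE|GE] := boolP (is_Graph (E `+` [mset (i, j); (j, k)])); last first.
  have GE'' := contra (rot _ _ _ u'') GE; have GE' := contra (rot _ _ _ u') GE''.
  by rewrite (Gamma_ofF GE) (Gamma_ofF GE') (Gamma_ofF GE'') !addr0 linear0.
have GE' := rot _ _ _ u GE; have GE'' := rot _ _ _ u' GE'.
rewrite (Gamma_ofT GE) (Gamma_ofT GE') (Gamma_ofT GE''); apply: Eil_proj0.
exact: (@I_arnold _ _ E i j k).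
Qed.

Lemma Eil_multiple E e f : [set e.1; e.2] = [set f.1; f.2] ->
  Eil_class (E `+` [mset e; f]) = 0.
Proof.
move=> ef; have [GE|GE] := boolP (is_Graph (E `+` [mset e; f])).
  by rewrite /Eil_class (Gamma_ofT GE); apply: Eil_proj0; apply: I_multiple ef.
by rewrite /Eil_class (Gamma_ofF GE) linear0.
Qed.

End OrientedRelations.

Lemma nth_index_ord (T : eqType) (x0 : T) (s : seq T) x : x \in s ->
  exists i : 'I_(size s), nth x0 s i = x.
Proof.
move=> xs; have := xs; rewrite -index_mem => lt.
by exists (Ordinal lt); apply: nth_index.
Qed.

(** * The map g on oriented graphs, followed by the projections *)

Section OrientedMap.
Variables (R : comNzRingType) (n : nat) (t : rptree) (vs : seq address).
Hypothesis t_leaves : size (leaves t) = n.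
Hypothesis vs_order : perm_eq vs (internal_vertices t).
Implicit Types (E : oedges n) (i j k : 'I_n) (v : address).

Local Open Scope mset_scope.

Lemma graph_atD v E E' : graph_at t v (E `+` E') = graph_at t v E `+` graph_at t v E'.
Proof.
rewrite /graph_at; set p := fun e : 'I_n * 'I_n => _.
have EE' : perm_eq (E `+` E') ((E : seq _) ++ (E' : seq _)).
  by apply/allP => e _; rewrite /= count_cat !count_mem_mset msetE2.
have /eq_seq_msetP-> := perm_pmap (edge_at t v) (perm_filter p EE').
rewrite filter_cat pmap_cat; apply/msetP => e.
by rewrite msetE2 !mset_seqE count_cat.
Qed.

Lemma graph_at1_out v i j : nadir t i j != v -> graph_at t v [mset (i, j)] = mset0.
Proof.
move=> /negbTE nv; rewrite /graph_at enum_msetn /= nv.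
by apply/msetP => e; rewrite mset_seqE mset0E.
Qed.

Lemma graph_at1_nadir v i j (a b : 'I_(arity t v)) :
    nadir t i j = v -> a = branch t v i :> nat -> b = branch t v j :> nat ->
  graph_at t v [mset (i, j)] = [mset (a, b)].
Proof.
move=> nv ai bj; rewrite /graph_at enum_msetn /= nv eqxx /edge_at /= -ai -bj.
rewrite !valK; apply/msetP => e.
by rewrite mset_seqE msetnE /= addn0 eq_sym; case: eqP.
Qed.

Lemma vertex_eq (x y : 'I_(size vs)) : (vertex x == vertex y) = (x == y).
Proof.
by rewrite /vertex nth_uniq // (perm_uniq vs_order) internal_vertices_uniq.
Qed.

Lemma nadir_index j k : j != k -> exists x : 'I_(size vs), nadir t j k = vertex x.
Proof.
move=> jk; have [vt _] := nadir_branches t_leaves jk erefl.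
rewrite -(perm_mem vs_order) in vt.
by have [x xv] := nth_index_ord [::] vt; exists x.
Qed.

Definition g_proj : {linear Gamma R n ->
    tensor (fun x : 'I_(size vs) => Eil R (arity t (vertex x)))} :=
  tensor_map (fun x => Eil_proj R (arity t (vertex x))) \o g R n t vs.

Lemma g_projU (G : Graph n) : g_proj << G >> =
  tens (fun x : 'I_(size vs) => Eil_class R (graph_at t (vertex x) (edges G))).
Proof. by rewrite /= liftU scale1r tensor_mapE. Qed.

Lemma Graph_edge (G : Graph n) e : e \in edges G -> e.1 != e.2.
Proof. by have /andP[/allP + _] := edgesP G; apply. Qed.

(** Only the factor at the nadir of i and j sees the change, and there it is again the reversal of
    one edge. *)
Lemma g_proj_symmetry E i j (G1 G2 : Graph n) :
    edges G1 = E `+` [mset (i, j)] -> edges G2 = E `+` [mset (j, i)] ->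
  g_proj << G1 >> = - g_proj << G2 >>.
Proof.
move=> E1 E2; have ij : i != j.
  by apply: (@Graph_edge G1 (i, j)); rewrite E1 in_msetD in_mset1 eqxx orbT.
have [x xv] := nadir_index ij; have xv' : nadir t j i = vertex x by rewrite nadirC.
rewrite !g_projU E1 E2; apply: (@tens_opp _ _ _ _ _ x) => [y xy|].
  by rewrite !graph_atD !graph_at1_out // ?xv ?xv' vertex_eq.
have [_ [a [b [_ ai bj]]]] := nadir_branches t_leaves ij xv.
rewrite !graph_atD (graph_at1_nadir xv ai bj) (graph_at1_nadir xv' bj ai).
exact: Eil_symmetry.
Qed.

Lemma g_proj_multiple E (e f : 'I_n * 'I_n) (G : Graph n) :
    edges G = E `+` [mset e; f] -> [set e.1; e.2] = [set f.1; f.2] ->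
  g_proj << G >> = 0.
Proof.
case: e f => [i j] [k l] EG ef; rewrite [_.1]/= [_.2]/= in ef; have ij : i != j.
  by apply: (@Graph_edge G (i, j)); rewrite EG !in_msetD !in_mset1 eqxx !orbT.
have [x xv] := nadir_index ij; have xv' : nadir t j i = vertex x by rewrite nadirC.
have [_ [a [b [_ ai bj]]]] := nadir_branches t_leaves ij xv.
rewrite g_projU EG; apply: (@tens_eq0 _ _ _ _ x).
rewrite !graph_atD (graph_at1_nadir xv ai bj).
have kl : k != l.
  by apply: (@Graph_edge G (k, l)); rewrite EG !in_msetD !in_mset1 eqxx !orbT.
have : k \in [set i; j] by rewrite ef set21.
have : l \in [set i; j] by rewrite ef set22.
(* As k and l are distinct, the second edge is (j, i) or (i, j), and it falls on the same two
   branches as the first. *)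
move=> /set2P[] lE /set2P[] kE; move: kl; rewrite kE lE ?eqxx // => _.
  by rewrite (graph_at1_nadir xv' bj ai); apply: Eil_multiple; rewrite /= setUC.
by rewrite (graph_at1_nadir xv ai bj); apply: Eil_multiple.
Qed.

Lemma g_proj_arnold i j k : uniq [:: i; j; k] -> forall E (G1 G2 G3 : Graph n),
    edges G1 = E `+` [mset (i, j); (j, k)] ->
    edges G2 = E `+` [mset (j, k); (k, i)] ->
    edges G3 = E `+` [mset (k, i); (i, j)] ->
  g_proj << G1 >> + g_proj << G2 >> + g_proj << G3 >> = 0.
Proof.
move: i j k; apply: (nadir_triple t_leaves).
- by move=> i j k H E G1 G2 G3 E1 E2 E3; rewrite addrC addrA; apply: H E3 E1 E2.
- move=> i j k v a b c u abc ijv jkv kiv ai bj ck E G1 G2 G3 E1 E2 E3.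
  have ij : i != j by move: u; rewrite /= !inE negb_or => /andP[/andP[]].
  have [x xv] := nadir_index ij; have vx : v = vertex x by rewrite -ijv.
  move: vx a b c abc ijv jkv kiv ai bj ck => -> a b c abc ijv jkv kiv ai bj ck.
  rewrite !g_projU E1 E2 E3.
  have out y : x != y -> [/\ nadir t i j != vertex y, nadir t j k != vertex y
      & nadir t k i != vertex y] by rewrite ijv jkv kiv vertex_eq.
  apply: (@tens_add3 _ _ _ _ _ _ x) => [y /out[? ? ?]|y /out[? ? ?]|].
  - by rewrite !graph_atD !graph_at1_out.
  - by rewrite !graph_atD !graph_at1_out.
  rewrite !graph_atD (graph_at1_nadir ijv ai bj) (graph_at1_nadir jkv bj ck).
  by rewrite (graph_at1_nadir kiv ck ai); apply: Eil_arnold.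
- move=> i j k v a b u ab ijv jkv kiv ai aj bk E G1 G2 G3 E1 E2 E3.
  have jk : j != k by move: u; rewrite /= !inE => /andP[_ /andP[]].
  have [x xv] := nadir_index jk; have vx : v = vertex x by rewrite -jkv.
  move: vx a b ab ijv jkv kiv ai aj bk => -> a b ab ijv jkv kiv ai aj bk.
  rewrite !g_projU E1 E2 E3.
  have out y : x != y -> nadir t j k != vertex y /\ nadir t k i != vertex y.
    by rewrite jkv kiv vertex_eq.
  (* At v the edges j -> k and k -> i of the second graph become a -> b and b -> a. *)
  rewrite [X in _ + X + _](@tens_eq0 _ _ _ _ x); last first.
    rewrite !graph_atD (graph_at1_nadir jkv aj bk) (graph_at1_nadir kiv bk ai).
    by apply: Eil_multiple; rewrite /= setUC.
  rewrite addr0; apply/eqP; rewrite addr_eq0; apply/eqP.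
  (* Away from v the first and third graphs agree, both keeping i -> j. At v the first has a -> b
     where the third has b -> a. *)
  apply: (@tens_opp _ _ _ _ _ x) => [y /out[jky kiy]|].
    by rewrite !graph_atD (graph_at1_out jky) (graph_at1_out kiy) mset0D msetD0.
  rewrite !graph_atD (graph_at1_out ijv) (graph_at1_nadir jkv aj bk).
  rewrite (graph_at1_nadir kiv bk ai) mset0D msetD0.
  exact: Eil_symmetry.
Qed.

End OrientedMap.

(** * Graphs with ordered edges *)

Lemma nth_swap (T : Type) (x0 : T) s1 a b s2 m (i j l : 'I_m) :
    i = size s1 :> nat -> j = (size s1).+1 :> nat ->
  nth x0 (s1 ++ [:: b; a] ++ s2) l = nth x0 (s1 ++ [:: a; b] ++ s2) (tperm i j l).
Proof.
move=> is1 js1; case: tpermP => [->|->|/eqP li /eqP lj].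
- by rewrite ![nth _ (s1 ++ _) _]nth_cat is1 js1 ltnn ltnNge leqnSn subnn subSnn.
- by rewrite ![nth _ (s1 ++ _) _]nth_cat is1 js1 ltnn ltnNge leqnSn subnn subSnn.
rewrite ![nth _ (s1 ++ _) _]nth_cat; case: ltnP => // s1l.
have : val l != val i by []. have : val l != val j by [].
rewrite /= is1 js1; rewrite -(subnKC s1l).
by case: (l - size s1)%N => [|[|k]]; rewrite ?addn0 ?addn1 ?eqxx // addKn.
Qed.

(** Since x and y occur once each, the transposition fixes all other entries. *)
Lemma map_tperm (T : finType) (x y : T) s1 s2 s3 :
  uniq (s1 ++ x :: s2 ++ y :: s3) ->
  map (tperm x y) (s1 ++ x :: s2 ++ y :: s3) = s1 ++ y :: s2 ++ x :: s3.
Proof.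
move=> u; have fix_s s : x \notin s -> y \notin s -> map (tperm x y) s = s.
  move=> xs ys; rewrite -[RHS]map_id; apply/eq_in_map => z zs.
  by rewrite tpermD //; [apply: contraNneq xs | apply: contraNneq ys] => ->.
have ux : uniq ([:: x] ++ s1 ++ s2 ++ y :: s3) by rewrite uniq_catCA.
have uy : uniq ([:: y] ++ (s1 ++ x :: s2) ++ s3) by rewrite uniq_catCA -catA.
move: ux uy; rewrite /= !mem_cat !inE !negb_or.
case/andP=> /and4P[x1 x2 xy x3] _ /andP[/andP[/and3P[y1 _ y2] y3] _].
by rewrite map_cat /= map_cat /= !fix_s // tpermL tpermR.
Qed.

(** * Functions of sequences that change sign under exchange of neighbours *)

Section Alternating.
Variables (R : pzRingType) (T : Type) (V : lmodType R) (F : seq T -> V).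
Hypothesis Fswap : forall s1 a b s2,
  F (s1 ++ [:: a; b] ++ s2) = - F (s1 ++ [:: b; a] ++ s2).

Lemma alternating_move s1 a s2 s3 :
  F (s1 ++ a :: s2 ++ s3) = (-1) ^+ size s2 *: F (s1 ++ s2 ++ a :: s3).
Proof.
elim: s2 s1 => [|b s2 IH] s1; first by rewrite expr0 scale1r.
rewrite [LHS](Fswap s1 a b (s2 ++ s3)) -[_ ++ _]cat_rcons IH.
by rewrite -scaleN1r scalerA -exprS cat_rcons.
Qed.

(** On both sides the first of the two entries is moved past s2, at the cost of the same sign; one
    exchange of neighbours remains. *)
Lemma alternating_far s1 a s2 b s3 :
  F (s1 ++ a :: s2 ++ b :: s3) = - F (s1 ++ b :: s2 ++ a :: s3).
Proof.
rewrite (alternating_move s1 a s2 (b :: s3)) (alternating_move s1 b s2 (a :: s3)).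
rewrite -scalerN; congr (_ *: _).
by have := Fswap (s1 ++ s2) a b s3; rewrite -!catA.
Qed.

Lemma alternating_tperm m (u : 'I_m -> T) (x y : 'I_m) : x != y ->
  F [seq u (tperm x y l) | l <- enum 'I_m] = - F [seq u l | l <- enum 'I_m].
Proof.
(* Generalized from the enumeration to any duplicate-free list of positions, which can be split at
   x' and y' in whichever order they occur. *)
have main s x' y' : x' != y' -> uniq s -> x' \in s -> y' \in s ->
  F [seq u (tperm x' y' l) | l <- s] = - F [seq u l | l <- s].
  move=> {x y} xy us /splitPr xs; case: xs us => s1 s2 us.
  rewrite mem_cat inE eq_sym (negbTE xy) /=.
  have split_ab z w r1 r2 r3 : uniq (r1 ++ z :: r2 ++ w :: r3) ->
      F [seq u (tperm z w l) | l <- r1 ++ z :: r2 ++ w :: r3]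
      = - F [seq u l | l <- r1 ++ z :: r2 ++ w :: r3].
    move=> ur; rewrite (map_comp u) map_tperm // !map_cat /= !map_cat /=.
    exact: alternating_far.
  case/orP=> /splitPr ys.
    by case: ys us => r1 r2; rewrite -catA /= tpermC => /split_ab.
  by case: ys us => r1 r2 /split_ab.
by move=> xy; apply: main; rewrite ?enum_uniq ?mem_enum.
Qed.

(** Induction on a decomposition of p into transpositions. In a product the left factor acts first,
    so the new transposition acts on positions, as [alternating_tperm] requires. *)
Lemma alternating_perm x0 s (p : 'S_(size s)) :
  F s = (-1) ^+ p *: F [seq nth x0 s (p l) | l <- enum 'I_(size s)].
Proof.
have [ts -> {p}] := prod_tpermP p.
elim: ts => [|[x y] ts IH].
  rewrite big_nil odd_perm1 expr0 scale1r => _; congr F; apply: (@eq_from_nth _ x0).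
    by rewrite size_map -cardE card_ord.
  move=> i si; rewrite (nth_map (Ordinal si)) -?cardE ?card_ord //.
  by rewrite perm1 nth_enum_ord.
rewrite [all _ _]/= => /andP[xy] /IH ->; rewrite big_cons odd_mul_tperm.
have /= {}xy : x != y := xy; rewrite xy.
set p := (\prod_(t <- ts) _)%g.
rewrite [in RHS](@eq_map _ _ _ (fun l => nth x0 s (p (tperm x y l)))); last first.
  by move=> l; rewrite permM.
rewrite (alternating_tperm (fun l => nth x0 s (p l))) // addTb signrN.
by rewrite scalerN scaleNr opprK.
Qed.

End Alternating.

(** * The relations among graphs with ordered edges *)

Section OrderedRelations.
Variables (R : comNzRingType) (n : nat).
Implicit Types (s : eoedges n) (i j k : 'I_n).

Lemma oGamma_ofT s (Gs : is_eoGraph s) : oGamma_of R s = << MkEoGraph Gs >>.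
Proof. by rewrite /oGamma_of insubT. Qed.

Lemma oGamma_ofF s : ~~ is_eoGraph s -> oGamma_of R s = 0.
Proof. by move=> Gs; rewrite /oGamma_of insubF //; apply/negbTE. Qed.

Definition oEil_class s : oEil R n := oEil_proj R n (oGamma_of R s).

Lemma oEil_classF s : ~~ is_eoGraph s -> oEil_class s = 0.
Proof. by move=> Gs; rewrite /oEil_class (oGamma_ofF Gs) linear0. Qed.

Lemma oEil_proj0 x : oI_gen x -> oEil_proj R n x = 0.
Proof.
move=> xI; rewrite -(linear0 (oEil_proj R n)); apply/qproj_eq.
by rewrite subr0; apply: span_gen.
Qed.

Lemma is_eoGraph_sub s s' :
    (forall i j, [set i; j] \in s -> connect (eoedges_adj s') i j) ->
    {in s', forall e : {set 'I_n}, #|e| == 2%N} -> is_eoGraph s -> is_eoGraph s'.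
Proof.
move=> ss' /allP cs' /andP[_ /forallP cs]; rewrite /is_eoGraph cs'.
apply/forallP => i; apply/forallP => j; have /forallP/(_ j) := cs i.
by apply: connect_sub => {}i {}j /ss'.
Qed.

Lemma is_eoGraph_mem s s' : s =i s' -> is_eoGraph s = is_eoGraph s'.
Proof.
have main s1 s2 : s1 =i s2 -> is_eoGraph s1 -> is_eoGraph s2.
  move=> s12 Gs1; have /andP[/allP cs1 _] := Gs1.
  apply: is_eoGraph_sub Gs1 => [i j ij|e]; last by rewrite -s12 => /cs1.
  by apply: connect1; rewrite /eoedges_adj /= -s12.
by move=> ss'; apply/idP/idP; apply: main => // e; rewrite ss'.
Qed.

Lemma mem_swap (T : eqType) (s1 s2 : seq T) a b :
  s1 ++ [:: a; b] ++ s2 =i s1 ++ [:: b; a] ++ s2.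
Proof. by move=> e; rewrite !mem_cat !inE [(e == a) || _]orbC. Qed.

Lemma oEil_multiple s : ~~ uniq s -> oEil_class s = 0.
Proof.
have [Gs us|/oEil_classF //] := boolP (is_eoGraph s).
by rewrite /oEil_class (oGamma_ofT Gs); apply: oEil_proj0; apply: oI_multiple.
Qed.

Lemma oEil_swap s1 a b s2 :
  oEil_class (s1 ++ [:: a; b] ++ s2) = - oEil_class (s1 ++ [:: b; a] ++ s2).
Proof.
have [Gs|Gs] := boolP (is_eoGraph (s1 ++ [:: a; b] ++ s2)); last first.
  rewrite (oEil_classF Gs) oEil_classF ?oppr0 //.
  by rewrite -(is_eoGraph_mem (mem_swap s1 s2 a b)).
have Gs' := Gs; rewrite (is_eoGraph_mem (mem_swap s1 s2 a b)) in Gs'.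
have lti : (size s1 < size (s1 ++ [:: a; b] ++ s2))%N.
  by rewrite size_cat /= addnS ltnS leq_addr.
have ltj : ((size s1).+1 < size (s1 ++ [:: a; b] ++ s2))%N.
  by rewrite size_cat /= !addnS !ltnS leq_addr.
pose i := Ordinal lti; pose j := Ordinal ltj.
have ij : i != j by rewrite -val_eqE /= neq_ltn ltnSn.
apply/eqP; rewrite -addr_eq0 /oEil_class -(linearD (oEil_proj R n)); apply/eqP.
(* The sum is rewritten as G - sign(p) G', where p is the transposition of the positions of a and
   b. *)
rewrite (oGamma_ofT Gs) (oGamma_ofT Gs') -[X in _ + X]opprK -[X in _ - X]scaleN1r.
have <- : (-1) ^+ tperm i j = -1 :> R by rewrite odd_tperm ij expr1.
apply: oEil_proj0; apply: oI_symmetry => /=.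
apply: (@eq_from_nth _ set0).
  by rewrite size_map -cardE card_ord !size_cat.
move=> k; have -> : size (s1 ++ [:: b, a & s2]) = size (s1 ++ [:: a; b] ++ s2).
  by rewrite !size_cat.
move=> lk; rewrite (nth_map i) -?cardE ?card_ord //.
rewrite -[k]/(nat_of_ord (Ordinal lk)) nth_ord_enum.
exact: (@nth_swap _ set0 s1 a b s2 _ i j (Ordinal lk)).
Qed.

Lemma oEil_arnold s1 s2 i j k : uniq [:: i; j; k] ->
  oEil_class (s1 ++ [:: [set i; j]; [set j; k]] ++ s2)
  + oEil_class (s1 ++ [:: [set j; k]; [set k; i]] ++ s2)
  + oEil_class (s1 ++ [:: [set k; i]; [set i; j]] ++ s2) = 0.
Proof.
have rot a b c : uniq [:: a; b; c] ->
    is_eoGraph (s1 ++ [:: [set a; b]; [set b; c]] ++ s2) ->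
    is_eoGraph (s1 ++ [:: [set b; c]; [set c; a]] ++ s2).
  rewrite /= !inE negb_or !andbT => /andP[/andP[ab ac] bc] Gs.
  have /andP[/allP cs _] := Gs; apply: is_eoGraph_sub Gs => [x y|e]; last first.
    rewrite mem_cat !inE => /or4P[e1|/eqP->|/eqP->|e2].
    - by rewrite cs ?mem_cat ?e1.
    - by rewrite cards2 bc.
    - by rewrite cards2 [c == a]eq_sym ac.
    - by rewrite cs // mem_cat !inE e2 !orbT.
  have adj x' y' : [set x'; y'] \in s1 ++ [:: [set b; c]; [set c; a]] ++ s2 ->
      connect (eoedges_adj (s1 ++ [:: [set b; c]; [set c; a]] ++ s2)) x' y'.
    exact: connect1.
  (* The lost edge between a and b is replaced by the path through c, in both directions, since an
     unordered edge does not record which endpoint comes first. *)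
  have cab : connect (eoedges_adj (s1 ++ [:: [set b; c]; [set c; a]] ++ s2)) a b.
    by apply: (@connect_trans _ _ c); apply: adj; rewrite mem_cat !inE setUC eqxx ?orbT.
  have cba : connect (eoedges_adj (s1 ++ [:: [set b; c]; [set c; a]] ++ s2)) b a.
    by apply: (@connect_trans _ _ c); apply: adj; rewrite mem_cat !inE eqxx ?orbT.
  rewrite mem_cat !inE => /or4P[e1|/eqP exy|/eqP exy|e2].
  - by apply: adj; rewrite mem_cat e1.
  - have : x \in [set a; b] by rewrite -exy set21.
    have : y \in [set a; b] by rewrite -exy set22.
    by move=> /set2P[] -> /set2P[] ->; rewrite ?connect0.
  - by apply: adj; rewrite mem_cat !inE exy eqxx !orbT.
  - by apply: adj; rewrite mem_cat !inE e2 !orbT.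
move=> u; have u' : uniq [:: j; k; i] by rewrite -(rot_uniq 2).
have u'' : uniq [:: k; i; j] by rewrite -(rot_uniq 1).
rewrite /oEil_class -linearD3.
have [Gs|Gs] := boolP (is_eoGraph (s1 ++ [:: [set i; j]; [set j; k]] ++ s2)); last first.
  have Gs'' := contra (rot _ _ _ u'') Gs; have Gs' := contra (rot _ _ _ u') Gs''.
  by rewrite (oGamma_ofF Gs) (oGamma_ofF Gs') (oGamma_ofF Gs'') !addr0 linear0.
have Gs' := rot _ _ _ u Gs; have Gs'' := rot _ _ _ u' Gs'.
rewrite (oGamma_ofT Gs) (oGamma_ofT Gs') (oGamma_ofT Gs''); apply: oEil_proj0.
exact: (@oI_arnold _ _ s1 s2 i j k).
Qed.

End OrderedRelations.

(* These generalize concat_order and edge_perm, separating the type 'I_m of the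
   positions from the sequence of edges, so that the permutations of different
   sequences of the same size can be compared. *)
Definition label_order m (vs : seq address) (lab : 'I_m -> pred address) : seq 'I_m :=
  [seq l | v <- vs, l <- [seq l <- enum 'I_m | lab l v]].

Definition label_perm m (vs : seq address) (lab : 'I_m -> pred address) : 'S_m :=
  odflt 1%g [pick p : 'S_m | label_order vs lab == [seq p l | l <- enum 'I_m]].

(** A permutation is determined by the list of its values, so the choice made by [pick] can only be
    p. *)
Lemma label_permP m vs (lab : 'I_m -> pred address) (p : 'S_m) :
  label_order vs lab = [seq p l | l <- enum 'I_m] -> label_perm vs lab = p.
Proof.
move=> labp; rewrite /label_perm; case: pickP => [q|/(_ p)]; rewrite labp ?eqxx //.
move=> /eqP/eq_in_map pq; apply/permP => l /=.
by rewrite pq ?mem_enum.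
Qed.

(** The positions i and j are neighbours in the enumeration and each block contains at most one of
    them, so exchanging them keeps every block in increasing order. *)
Lemma label_order_tperm m vs (lab : 'I_m -> pred address) (i j : 'I_m) :
    j = i.+1 :> nat -> (forall v, ~~ (lab i v && lab j v)) ->
  label_order vs (lab \o tperm i j) = map (tperm i j) (label_order vs lab).
Proof.
move=> ji nlab; rewrite /label_order map_flatten -map_comp; congr flatten.
apply: eq_map => v /=; rewrite !map_id.
set s := enum 'I_m; pose s1 := take i s; pose s2 := drop j.+1 s.
have Es : s = s1 ++ i :: [::] ++ j :: s2.
  have szs : size s = m by rewrite -cardE card_ord.
  rewrite -[LHS](cat_take_drop i) (drop_nth i) ?szs // nth_ord_enum.
  by rewrite -ji (drop_nth i) ?szs // nth_ord_enum.
have tE : map (tperm i j) s = s1 ++ j :: [::] ++ i :: s2.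
  by rewrite Es map_tperm // -Es enum_uniq.
(* Writing the enumeration as a double image lets one transposition be pulled out of the filter
   while the other cancels the one in the labels. *)
have tK : s = map (tperm i j) (map (tperm i j) s).
  by rewrite -map_comp -[LHS]map_id; apply: eq_map => l /=; rewrite tpermK.
rewrite [in LHS]tK tE filter_map; congr (map _ _).
rewrite (@eq_filter _ _ (lab^~ v)); last by move=> l /=; rewrite tpermK.
rewrite Es !filter_cat /=; congr (_ ++ _); have := nlab v.
by case: (lab i v); case: (lab j v).
Qed.

(** * The map og on graphs with ordered edges, followed by the projections *)

Section OrderedMap.
Variables (R : comNzRingType) (n : nat) (t : rptree) (vs : seq address).
Hypothesis t_leaves : size (leaves t) = n.
Hypothesis vs_order : perm_eq vs (internal_vertices t).
Implicit Types (s : eoedges n) (i j k : 'I_n) (v : address).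

Let labels s m (l : 'I_m) : pred address := has_nadir t (nth set0 s l).

(** Only parities are compared, because the two permutations act on different types unless m is
    literally [size s]. *)
Lemma edge_perm_label s m : size s = m ->
  edge_perm t vs s = label_perm vs (@labels s m) :> bool.
Proof. by case: m /. Qed.

Lemma label_orderP s m : is_eoGraph s -> size s = m ->
  label_order vs (@labels s m) =
  [seq label_perm vs (@labels s m) l | l <- enum 'I_m].
Proof.
by move=> Gs; case: m /; apply: (edge_permP (MkEoGraph Gs) t_leaves vs_order).
Qed.

(** If a and b belong to different factors, the concatenation lists the same edges as before. Only
    their positions in the sequence move, so the permutation is composed with a transposition. *)
Lemma edge_perm_swap s1 a b s2 : is_eoGraph (s1 ++ [:: a; b] ++ s2) ->
    (forall v, ~~ (has_nadir t a v && has_nadir t b v)) ->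
  edge_perm t vs (s1 ++ [:: b; a] ++ s2)
  = ~~ edge_perm t vs (s1 ++ [:: a; b] ++ s2) :> bool.
Proof.
set s := s1 ++ _ => Gs ab; set s' := s1 ++ _.
have ss : size s' = size s by rewrite !size_cat.
have lti : (size s1 < size s)%N.
  by rewrite size_cat /= addnS ltnS leq_addr.
have ltj : ((size s1).+1 < size s)%N.
  by rewrite size_cat /= !addnS !ltnS leq_addr.
pose i := Ordinal lti; pose j := Ordinal ltj.
have ij : i != j by rewrite -val_eqE /= neq_ltn ltnSn.
rewrite (edge_perm_label ss) (edge_perm_label (erefl (size s))).
have labE : @labels s' (size s) = @labels s (size s) \o tperm i j.
  by apply: functional_extensionality_dep => l;
    rewrite /labels /= (@nth_swap _ set0 s1 a b s2 _ i j).
set p := label_perm vs (@labels s _).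
rewrite labE (@label_permP _ _ _ (p * tperm i j)%g).
  by rewrite odd_permM odd_tperm ij addbT.
rewrite label_order_tperm // => [|v].
  rewrite (label_orderP Gs erefl) -map_comp; apply: eq_map => l /=.
  by rewrite permM.
rewrite /labels /= /s ![nth _ (s1 ++ _) _]nth_cat ltnn ltnNge leqnSn subnn subSnn.
exact: ab.
Qed.

(** The permutation depends on each edge only through its nadir. *)
Lemma edge_perm_same s1 a b a' b' s2 :
    has_nadir t a =1 has_nadir t a' -> has_nadir t b =1 has_nadir t b' ->
  edge_perm t vs (s1 ++ [:: a; b] ++ s2)
  = edge_perm t vs (s1 ++ [:: a'; b'] ++ s2) :> bool.
Proof.
move=> aa' bb'; set s := s1 ++ _; set s' := s1 ++ _.
have ss : size s' = size s by rewrite !size_cat.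
rewrite (edge_perm_label ss) (edge_perm_label (erefl (size s))).
congr (odd_perm (label_perm _ _)).
apply: functional_extensionality_dep => l; apply: functional_extensionality_dep => v.
rewrite /labels ![nth _ (s1 ++ _) _]nth_cat; case: ifP => // _.
by case: (l - size s1)%N => [|[|]] /=.
Qed.

Lemma eograph_at_cat v s s' :
  eograph_at t v (s ++ s') = eograph_at t v s ++ eograph_at t v s'.
Proof. by rewrite /eograph_at filter_cat map_cat. Qed.

Lemma eograph_at2 v (e f : {set 'I_n}) :
  eograph_at t v [:: e; f] = eograph_at t v [:: e] ++ eograph_at t v [:: f].
Proof. exact: (eograph_at_cat v [:: e] [:: f]). Qed.

Lemma eograph_at1_out v j k : j != k -> nadir t j k != v ->
  eograph_at t v [:: [set j; k]] = [::].
Proof. by move=> jk /negbTE nv; rewrite /eograph_at /= has_nadir2 // nv. Qed.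

Lemma eograph_at1_nadir v j k (a b : 'I_(arity t v)) : j != k ->
    nadir t j k = v -> a = branch t v j :> nat -> b = branch t v k :> nat ->
  eograph_at t v [:: [set j; k]] = [:: [set a; b]].
Proof.
move=> jk nv aj bk; rewrite /eograph_at /= has_nadir2 // nv eqxx /=; congr [:: _].
apply/setP => c; rewrite !inE; apply/exists_inP/orP => [[l]|].
  by move=> /set2P[] -> /eqP lc; [left|right]; apply/eqP/val_inj; rewrite /= -lc ?aj ?bk.
by case=> /eqP->; [exists j|exists k]; rewrite ?set21 ?set22 // ?aj ?bk.
Qed.

Definition og_proj : {linear oGamma R n ->
    tensor (fun x : 'I_(size vs) => oEil R (arity t (vertex x)))} :=
  tensor_map (fun x => oEil_proj R (arity t (vertex x))) \o og R n t vs.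

Definition og_tens s :=
  tens (fun x : 'I_(size vs) => oEil_class R (eograph_at t (vertex x) s)).

Lemma og_projU (G : eoGraph n) (s := ordered_edges G) : og_proj << G >> =
  (-1) ^+ edge_perm t vs s *: og_tens s.
Proof. by rewrite /= liftU scale1r linearZ; congr (_ *: _); apply: tensor_mapE. Qed.

(** Extended by 0 to all edge sequences, because [alternating_perm] applies to a function defined on
    every sequence. *)
Definition og_class s := og_proj (oGamma_of R s).

Lemma og_classT s : is_eoGraph s ->
  og_class s = (-1) ^+ edge_perm t vs s *: og_tens s.
Proof. by move=> Gs; rewrite /og_class (oGamma_ofT _ Gs) og_projU. Qed.

Lemma og_classF s : ~~ is_eoGraph s -> og_class s = 0.
Proof. by move=> Gs; rewrite /og_class (oGamma_ofF _ Gs) linear0. Qed.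

Lemma eoGraph_edge s e : is_eoGraph s -> e \in s -> exists j k, j != k /\ e = [set j; k].
Proof.
by move=> /andP[/allP cs _] /cs /cards2P[j [k [jk ->]]]; exists j, k.
Qed.

Lemma og_swap s1 a b s2 :
  og_class (s1 ++ [:: a; b] ++ s2) = - og_class (s1 ++ [:: b; a] ++ s2).
Proof.
have sw := is_eoGraph_mem (mem_swap s1 s2 a b).
have [Gs|Gs] := boolP (is_eoGraph (s1 ++ [:: a; b] ++ s2)); last first.
  by rewrite (og_classF Gs) og_classF ?oppr0 // -sw.
rewrite (og_classT Gs) og_classT -?sw //.
have [i [j [ij aE]]] : exists i j, i != j /\ a = [set i; j].
  by apply: (eoGraph_edge Gs); rewrite mem_cat !inE eqxx orbT.
have [k [l [kl bE]]] : exists k l, k != l /\ b = [set k; l].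
  by apply: (eoGraph_edge Gs); rewrite mem_cat !inE eqxx !orbT.
have [nab|nab] := eqVneq (nadir t i j) (nadir t k l).
  have ab : has_nadir t a =1 has_nadir t b.
    by move=> v; rewrite aE bE !has_nadir2 // nab.
  (* With equal nadirs the sign of the permutation stays, and the factor at the common nadir changes
     sign. *)
  rewrite (@edge_perm_same s1 a b b a s2) // -scalerN; congr (_ *: _).
  have [x xv] := nadir_index t_leaves vs_order ij.
  have xv' : nadir t k l = vertex x by rewrite -nab.
  have [_ [c [d [_ ci dj]]]] := nadir_branches t_leaves ij xv.
  have [_ [e [f [_ ek fl]]]] := nadir_branches t_leaves kl xv'.
  apply: (@tens_opp _ _ _ _ _ x) => [y xy|].
    have ny : nadir t i j != vertex y by rewrite xv (vertex_eq vs_order).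
    have ny' : nadir t k l != vertex y by rewrite xv' (vertex_eq vs_order).
    by rewrite !eograph_at_cat aE bE !eograph_at2 !eograph_at1_out.
  rewrite !eograph_at_cat aE bE !eograph_at2 (eograph_at1_nadir ij xv ci dj).
  by rewrite (eograph_at1_nadir kl xv' ek fl); apply: oEil_swap.
rewrite (@edge_perm_swap s1 a b s2) // => [|v]; last first.
  by rewrite aE bE !has_nadir2 //; apply: contra nab => /andP[/eqP-> /eqP->].
rewrite signrN scaleNr opprK; congr (_ *: tens _).
apply: functional_extensionality_dep => x; rewrite !eograph_at_cat aE bE.
(* No factor receives both edges, so at each vertex one of them contributes the empty sequence and
   their order is immaterial. *)
rewrite !eograph_at2; have [nx|nx] := eqVneq (nadir t k l) (vertex x).
  by rewrite (@eograph_at1_out _ i j) ?cats0 // -nx.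
by rewrite [eograph_at t _ [:: [set k; l]]]eograph_at1_out ?cats0.
Qed.

Lemma og_proj_arnold i j k : uniq [:: i; j; k] -> forall s1 s2 (G1 G2 G3 : eoGraph n),
    ordered_edges G1 = s1 ++ [:: [set i; j]; [set j; k]] ++ s2 ->
    ordered_edges G2 = s1 ++ [:: [set j; k]; [set k; i]] ++ s2 ->
    ordered_edges G3 = s1 ++ [:: [set k; i]; [set i; j]] ++ s2 ->
  og_proj << G1 >> + og_proj << G2 >> + og_proj << G3 >> = 0.
Proof.
move: i j k; apply: (nadir_triple t_leaves).
- by move=> i j k H s1 s2 G1 G2 G3 E1 E2 E3; rewrite addrC addrA; apply: H E3 E1 E2.
- move=> i j k v a b c u abc ijv jkv kiv ai bj ck s1 s2 G1 G2 G3 E1 E2 E3.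
  have [ij jk ki] : [/\ i != j, j != k & k != i].
    by move: u; rewrite /= !inE negb_or [k == i]eq_sym andbT => /andP[/andP[]].
  have [x xv] := nadir_index t_leaves vs_order ij; have vx : v = vertex x by rewrite -ijv.
  move: vx a b c abc ijv jkv kiv ai bj ck => -> a b c abc ijv jkv kiv ai bj ck.
  have ijE w : has_nadir t [set i; j] w = (vertex x == w) by rewrite has_nadir2 // ijv.
  have jkE w : has_nadir t [set j; k] w = (vertex x == w) by rewrite has_nadir2 // jkv.
  have kiE w : has_nadir t [set k; i] w = (vertex x == w) by rewrite has_nadir2 // kiv.
  (* The edges ij, jk and ki share their nadir, so the three terms carry the same sign, which
     factors out. *)
  have p2 : edge_perm t vs (s1 ++ [:: [set j; k]; [set k; i]] ++ s2)
      = edge_perm t vs (s1 ++ [:: [set i; j]; [set j; k]] ++ s2) :> bool.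
    by apply: edge_perm_same => w; rewrite ?ijE ?jkE ?kiE.
  have p3 : edge_perm t vs (s1 ++ [:: [set k; i]; [set i; j]] ++ s2)
      = edge_perm t vs (s1 ++ [:: [set i; j]; [set j; k]] ++ s2) :> bool.
    by apply: edge_perm_same => w; rewrite ?ijE ?jkE ?kiE.
  rewrite !og_projU E1 E2 E3 p2 p3.
  rewrite -!scalerDr [X in _ *: X](_ : _ = 0) ?scaler0 //.
  have out y : x != y -> [/\ nadir t i j != vertex y, nadir t j k != vertex y
      & nadir t k i != vertex y] by rewrite ijv jkv kiv (vertex_eq vs_order).
  apply: (@tens_add3 _ _ _ _ _ _ x) => [y /out[? ? ?]|y /out[? ? ?]|].
  - by rewrite !eograph_at_cat !eograph_at2 !eograph_at1_out.
  - by rewrite !eograph_at_cat !eograph_at2 !eograph_at1_out.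
  rewrite !eograph_at_cat !eograph_at2 (eograph_at1_nadir ij ijv ai bj).
  rewrite (eograph_at1_nadir jk jkv bj ck) (eograph_at1_nadir ki kiv ck ai).
  exact: oEil_arnold.
- move=> i j k v a b u ab ijv jkv kiv ai aj bk s1 s2 G1 G2 G3 E1 E2 E3.
  have [ij jk ki] : [/\ i != j, j != k & k != i].
    by move: u; rewrite /= !inE negb_or [k == i]eq_sym andbT => /andP[/andP[]].
  have [x xv] := nadir_index t_leaves vs_order jk; have vx : v = vertex x by rewrite -jkv.
  move: vx a b ab ijv jkv kiv ai aj bk => -> a b ab ijv jkv kiv ai aj bk.
  have -> : og_proj << G2 >> = 0.
    rewrite og_projU E2 /og_tens (@tens_eq0 _ _ _ _ x) ?scaler0 //.
    apply: oEil_multiple; rewrite !eograph_at_cat !eograph_at2.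
    rewrite (eograph_at1_nadir jk jkv aj bk) (eograph_at1_nadir ki kiv bk ai).
    by rewrite uniq_catCA /= inE setUC eqxx.
  rewrite addr0; apply/eqP; rewrite addr_eq0; apply/eqP.
  have -> : og_proj << G1 >> = og_class (ordered_edges G1).
    by rewrite og_projU og_classT // ordered_edgesP.
  (* Exchanging ij and jk in the first graph costs a sign and puts jk where the third graph has ki.
     These two edges have the same nadir v and both become the edge ab there. *)
  rewrite E1 og_swap og_projU E3 og_classT; last first.
    by rewrite (is_eoGraph_mem (mem_swap _ _ _ _)) -E1 ordered_edgesP.
  have same : has_nadir t [set j; k] =1 has_nadir t [set k; i].
    by move=> w; rewrite !has_nadir2 // jkv kiv.
  have pE : edge_perm t vs (s1 ++ [:: [set j; k]; [set i; j]] ++ s2)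
      = edge_perm t vs (s1 ++ [:: [set k; i]; [set i; j]] ++ s2) :> bool.
    exact: edge_perm_same.
  rewrite pE; congr (- (_ *: tens _)); apply: functional_extensionality_dep => y.
  rewrite !eograph_at_cat !eograph_at2; congr (oEil_class R (_ ++ (_ ++ _) ++ _)).
  have [<-|xy] := eqVneq x y.
    rewrite (eograph_at1_nadir jk jkv aj bk) (eograph_at1_nadir ki kiv bk ai).
    by rewrite setUC.
  by rewrite !eograph_at1_out // ?jkv ?kiv (vertex_eq vs_order).
Qed.

Lemma og_proj_symmetry (G1 G2 : eoGraph n) (p : 'S_(size (ordered_edges G1))) :
    ordered_edges G2 = [seq nth set0 (ordered_edges G1) (p l)
                       | l <- enum 'I_(size (ordered_edges G1))] ->
  og_proj << G1 >> = (-1) ^+ p *: og_proj << G2 >>.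
Proof.
have classG (G : eoGraph n) : og_proj << G >> = og_class (ordered_edges G).
  by rewrite og_projU og_classT // ordered_edgesP.
by move=> E2; rewrite !classG E2; apply: (alternating_perm og_swap).
Qed.

(** The two copies of the repeated edge have the same nadir and yield a repeated edge in that
    factor. *)
Lemma og_proj_multiple (G : eoGraph n) : ~~ uniq (ordered_edges G) -> og_proj << G >> = 0.
Proof.
move=> uG; have [s1 [e [s2 [s3 sE]]]] : exists s1 e s2 s3,
    ordered_edges G = s1 ++ [:: e] ++ s2 ++ [:: e] ++ s3.
  elim: (ordered_edges G) uG => //= e s IH; rewrite negb_and negbK.
  case/orP=> [/splitPr[s2 s3]|/IH[s1 [e' [s2 [s3 ->]]]]]; first by exists [::], e, s2, s3.
  by exists (e :: s1), e', s2, s3.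
have [i [j [ij eE]]] : exists i j, i != j /\ e = [set i; j].
  by apply: (eoGraph_edge (ordered_edgesP G)); rewrite sE mem_cat !inE eqxx orbT.
have [x xv] := nadir_index t_leaves vs_order ij.
have [_ [a [b [_ ai bj]]]] := nadir_branches t_leaves ij xv.
rewrite og_projU sE /og_tens (@tens_eq0 _ _ _ _ x) ?scaler0 //.
apply: oEil_multiple; rewrite !eograph_at_cat eE (eograph_at1_nadir ij xv ai bj).
by rewrite uniq_catCA /= !mem_cat inE eqxx !orbT.
Qed.

End OrderedMap.

(** * The induced maps on the quotients *)

Theorem corollary6p6 (R : comNzRingType) (n : nat) (t : rptree)
    (vs : seq address)
    (t_leaves : size (leaves t) = n)
    (vs_order : perm_eq vs (internal_vertices t)) :
  (exists! gbar : Eil R n ->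
      tensor (fun i : 'I_(size vs) => Eil R (arity t (vertex i))),
    linear gbar
    /\ forall x : Gamma R n,
         gbar (Eil_proj R n x)
         = tensor_map (fun i => Eil_proj R (arity t (vertex i)))
             (g R n t vs x))
  /\
  (exists! gbar : oEil R n ->
      tensor (fun i : 'I_(size vs) => oEil R (arity t (vertex i))),
    linear gbar
    /\ forall x : oGamma R n,
         gbar (oEil_proj R n x)
         = tensor_map (fun i => oEil_proj R (arity t (vertex i)))
             (og R n t vs x)).
Proof.
split.
  apply: (@qlift_unique _ _ _ _ (g_proj R n t vs)) => x.
  case=> [E i j k G1 G2 G3 u E1 E2 E3|E i j G1 G2 E1 E2|E e f G EG ef].
  - by rewrite linearD3; apply: g_proj_arnold E1 E2 E3.
  - by rewrite linearD (g_proj_symmetry R t_leaves vs_order E1 E2) addNr.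
  - exact: g_proj_multiple EG ef.
apply: (@qlift_unique _ _ _ _ (og_proj R n t vs)) => x.
case=> [s1 s2 i j k G1 G2 G3 u E1 E2 E3|G1 G2 p E2|G uG].
- by rewrite linearD3; apply: og_proj_arnold E1 E2 E3.
- by rewrite linearB linearZ (og_proj_symmetry R t_leaves vs_order E2) subrr.
- exact: og_proj_multiple uG.
Qed.
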